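(* Let $m$ be a model parameter and $u$ the wavefield data associated with $m$ through the acoustic wave equation $$\Bigl(m(x)\,\partial_t^2-\nabla\cdot\bigl(\tfrac{1}{\rho(x)}\nabla\bigr)\Bigr)u(x,t)=f(x,t).$$ Let $\mathcal{D}$ be an encoding map with range contained in $\mathcal{U}$, and let $\nu\in\mathcal{U}$ be fixed. If $\mathcal{D}$ is differentiable, then the value of the gradient $$\frac{\mathrm{d}}{\mathrm{d}m}\mathcal{T}(\mathcal{D}(u(m)),\nu)$$ given by the adjoint state method does not depend on the choice of the Kantorovich potential. That is, for a Kantorovich potential $\varphi$ for $(\mathcal{D}(u),\nu)$ associated with $\mathcal{D}(u)$, let $v_\varphi$ be the solution of $$\Bigl(m(x)\,\partial_t^2-\nabla\cdot\bigl(\tfrac{1}{\rho(x)}\nabla\bigr)\Bigr)v_\varphi=\mathcal{D}'[u]^*(\varphi),\qquad v_\varphi(x,T)=0,\quad \partial_t v_\varphi(x,T)=0,$$ and let $$g_\varphi(x)=-\int_0^T v_\varphi(x,t)\,\partial_t^2u(x,t)\,\mathrm{d}t .$$ Then $g_{\varphi_0}=g_{\varphi_1}$ almost everywhere for any two Kantorovich potentials $\varphi_0,\varphi_1$ for $(\mathcal{D}(u),\nu)$ associated with $\mathcal{D}(u)$.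
   Context: Wave equation: $T>0$ is the final time, $(x,t)\in\mathbb{R}^n\times[0,T]$; $m$ (reciprocal of the bulk modulus) and $\rho$ (density) are positive functions, bounded above and below by positive constants, and $f$ is a given source; $\rho$ and $f$ are known and fixed. It is assumed that coefficients and data are regular enough that the forward problem and the terminal-value problem for $v_\varphi$ with source in $L_2$ are well posed (unique finite-energy solutions) and that $\partial_t^2u\in L_2$. Data domain: $X\subset\mathbb{R}^n\times[0,T]$ is the compact domain (closure of a bounded, nonempty, simply connected, in particular connected, open set) on which the data are recorded; $\mathcal{D}(u)$ means $\mathcal{D}(u|_X)$, and $\mathcal{D}'[u]^*(\varphi)$ is extended by zero outside $X$. $\mathcal{P}$ is the set of probability measures on $X$ absolutely continuous with respect to Lebesgue measure, identified with their densities. $\mathcal{U}$ is the set of $\mu\in\mathcal{P}$ for which there is $r>0$ with $\mu(A)\ge r|A|$ for every Borel set $A\subset X$, where $|A|$ is Lebesgue measure. Encoding map: a (generally nonlinear) map $\mathcal{D}$ from $L_2(X)$ to $L_2(X)$ taking data to probability densities in $\mathcal{U}$. Differentiable means Fréchet differentiable; $\mathcal{D}'[u]:L_2(X)\to L_2(X)$ is the derivative at $u|_X$ and $\mathcal{D}'[u]^*$ its $L_2$ adjoint. Transportation cost: for $\mu,\nu\in\mathcal{P}$, $\mathcal{T}(\mu,\nu)=\min_\pi\int_{X\times X}\frac12|x-y|^2\,\mathrm{d}\pi(x,y)$ over all couplings $\pi$ of $\mu$ and $\nu$. By Kantorovich duality this equals the maximum of $\int\varphi\,\mathrm{d}\mu+\int\psi\,\mathrm{d}\nu$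 over pairs $(\varphi,\psi)\in L^1(\mathrm{d}\mu)\times L^1(\mathrm{d}\nu)$ with $\varphi(x)+\psi(y)\le\frac12|x-y|^2$ for all $x,y\in X$. A Kantorovich potential for $(\mu,\nu)$ associated with $\mu$ is the first component $\varphi$ of a maximizing pair. *)

(* Defs.v *)
From HB Require Import structures.
From mathcomp Require Import all_boot all_order all_algebra generic_quotient.
From mathcomp Require Import finmap.
From mathcomp Require Import all_classical all_reals all_analysis.
From mathcomp Require Import measurable_realfun.
Set Implicit Arguments.
Unset Strict Implicit.
Unset Printing Implicit Defensive.
Import Order.TTheory GRing.Theory Num.Theory.
Import numFieldNormedType.Exports.
Local Open Scope classical_set_scope.
Local Open Scope ring_scope.

(* The library has the lmodType LfunType of square-integrable functions but no
   normed structure on its quotient by almost-everywhere equality.  L2 mu is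
   that quotient; L2_fun picks a representative. *)
Section L2_space.
Local Open Scope quotient_scope.
Context {d} {T : measurableType d} {R : realType} (mu : {measure set T -> \bar R}).

Local Notation LF := (LfunType mu (lee1n 2)).

Definition L2_eqv (f g : LF) : bool := `[< f = g %[ae mu] >].

Let L2_eqv_refl : reflexive L2_eqv.
Proof. by move=> f; exact/asboolP/ae_eq_refl. Qed.

Let L2_eqv_sym : symmetric L2_eqv.
Proof. by move=> f g; apply/idP/idP => /asboolP h; exact/asboolP/ae_eq_sym. Qed.

Let L2_eqv_trans : transitive L2_eqv.
Proof.
by move=> f g h /asboolP gf /asboolP fh; exact/asboolP/(ae_eq_trans gf fh).
Qed.

Canonical L2_eqv_canonical :=
  EquivRel L2_eqv L2_eqv_refl L2_eqv_sym L2_eqv_trans.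

Definition L2 : Type := {eq_quot L2_eqv}.
HB.instance Definition _ := Choice.on L2.
HB.instance Definition _ := EqQuotient.on L2.

Definition L2_fun (f : L2) : T -> R := repr f.
Coercion L2_fun : L2 >-> Funclass.

(* Total: 0 when f is not square-integrable. *)
Definition L2_class (f : T -> R) : L2 :=
  if pselect (f \in Lfun mu 2) is left fL2 then \pi_L2 (Lfun_Sub (lee1n 2) fL2)
  else \pi_L2 (0 : LF).

Lemma L2_piP (f g : LF) : \pi_L2 f = \pi_L2 g <-> f = g %[ae mu].
Proof.
split=> [h|h]; first by move/eqmodP: h => /asboolP.
by apply/eqmodP/asboolP.
Qed.

Lemma L2_repr_pi (f : LF) : (repr (\pi_L2 f) : T -> R) = f %[ae mu].
Proof. by apply/L2_piP; rewrite reprK. Qed.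

Definition L2_add (f g : L2) : L2 := \pi_L2 (repr f + repr g).
Definition L2_opp (f : L2) : L2 := \pi_L2 (- repr f).
Definition L2_scale (a : R) (f : L2) : L2 := \pi_L2 (a *: repr f).

Lemma L2_addE (f g : LF) : L2_add (\pi_L2 f) (\pi_L2 g) = \pi_L2 (f + g).
Proof.
apply/L2_piP; have := L2_repr_pi f; have := L2_repr_pi g.
apply: filterS2 => x /(_ I) gx /(_ I) fx _.
by rewrite -[LHS]/(repr (\pi_L2 f) x + repr (\pi_L2 g) x) fx gx.
Qed.
Lemma L2_oppE (f : LF) : L2_opp (\pi_L2 f) = \pi_L2 (- f).
Proof.
apply/L2_piP; have := L2_repr_pi f.
apply: filterS => x /(_ I) fx _.
by rewrite -[LHS]/(- repr (\pi_L2 f) x) fx.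
Qed.
Lemma L2_scaleE a (f : LF) : L2_scale a (\pi_L2 f) = \pi_L2 (a *: f).
Proof.
apply/L2_piP; have := L2_repr_pi f.
apply: filterS => x /(_ I) fx _.
by rewrite -[LHS]/(a * repr (\pi_L2 f) x) fx.
Qed.

Let L2_addA : associative L2_add.
Proof.
elim/quotW => f; elim/quotW => g; elim/quotW => h.
by rewrite (L2_addE g h) (L2_addE f g) (L2_addE f) (L2_addE _ h) addrA.
Qed.
Let L2_addC : commutative L2_add.
Proof.
by elim/quotW => f; elim/quotW => g; rewrite (L2_addE f g) (L2_addE g f) addrC.
Qed.
Let L2_add0 : left_id (\pi_L2 (0 : LF)) L2_add.
Proof. by elim/quotW => f; rewrite L2_addE add0r. Qed.
Let L2_addN : left_inverse (\pi_L2 (0 : LF)) L2_opp L2_add.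
Proof. by elim/quotW => f; rewrite (L2_oppE f) (L2_addE _ f) addNr. Qed.

HB.instance Definition _ :=
  GRing.isZmodule.Build L2 L2_addA L2_addC L2_add0 L2_addN.

Let L2_scaleA a b v : L2_scale a (L2_scale b v) = L2_scale (a * b) v.
Proof.
by elim/quotW: v => f; rewrite (L2_scaleE b f) (L2_scaleE a) L2_scaleE scalerA.
Qed.
Let L2_scale1 : left_id 1 L2_scale.
Proof. by elim/quotW => f; rewrite L2_scaleE scale1r. Qed.
Let L2_scaleDr : right_distributive L2_scale +%R.
Proof.
move=> a; elim/quotW => f; elim/quotW => g.
rewrite -[X in L2_scale a X]/(L2_add _ _) -[RHS]/(L2_add _ _).
by rewrite (L2_addE f g) !L2_scaleE L2_addE scalerDr.
Qed.
Let L2_scaleDl v : {morph L2_scale^~ v : a b / a + b}.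
Proof.
move=> a b; elim/quotW: v => f; rewrite -[RHS]/(L2_add _ _).
by rewrite !L2_scaleE L2_addE scalerDl.
Qed.

HB.instance Definition _ := GRing.Zmodule_isLmodule.Build R L2
  L2_scaleA L2_scale1 L2_scaleDr L2_scaleDl.

Definition L2_norm (f : L2) : R := fine (Lnorm mu 2 (EFin \o f)).

Lemma L2_normE (f : LF) : (L2_norm (\pi_L2 f))%:E = ('N[mu]_2 [EFin \o f])%E.
Proof.
rewrite /L2_norm (_ : ('N[mu]_2 [_] = 'N[mu]_2 [EFin \o f])%E).
  by rewrite -(finite_norm_fine f).
rewrite unlock /=; congr (_ `^ _)%E.
apply: ge0_ae_eq_integral => //.
- apply/measurable_EFinP/(measurableT_comp (measurable_powR 2)).
  exact: measurableT_comp.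
- apply/measurable_EFinP/(measurableT_comp (measurable_powR 2)).
  exact: measurableT_comp.
have := L2_repr_pi f; apply: filterS => x /(_ I) fx _ /=.
by rewrite -[L2_fun _ x]/(repr (\pi_L2 f) x) fx.
Qed.

Let L2_normD (x y : L2) : L2_norm (x + y) <= L2_norm x + L2_norm y.
Proof.
rewrite -[x]reprK -[y]reprK; move: (repr x) (repr y) => f g.
rewrite -[X in L2_norm X]/(L2_add _ _) L2_addE.
have : ('N[mu]_2 [EFin \o (f + g)%R] <= 'N[mu]_2 [EFin \o f] + 'N[mu]_2 [EFin \o g])%E.
  by apply: eminkowski => //; rewrite lee1n.
by rewrite -(L2_normE f) -(L2_normE g) -(L2_normE (f + g)) -EFinD lee_fin.
Qed.
Let L2_normZ (l : R) (x : L2) : L2_norm (l *: x) = `|l| * L2_norm x.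
Proof.
rewrite -[x]reprK; move: (repr x) => f.
rewrite -[X in L2_norm X]/(L2_scale _ _) L2_scaleE.
by apply: EFin_inj; rewrite EFinM (L2_normE f) (L2_normE (l *: f)) LnormZ.
Qed.
Let L2_norm0 (x : L2) : L2_norm x = 0 -> x = 0.
Proof.
rewrite -[x]reprK; move: (repr x) => f nf0; apply/L2_piP/fine_Lnormr_eq0.
by apply: EFin_inj; rewrite finite_norm_fine -(L2_normE f) nf0.
Qed.

HB.instance Definition _ := Lmodule_isNormed.Build R L2 L2_normD L2_normZ L2_norm0.

Definition L2_dot (f g : L2) : R := \int[mu]_x (f x * g x).

End L2_space.
Arguments L2_class {d T R} mu f.
(* 'rV[R]_n carries the sigma-algebra generated by its coordinates, i.e. the
   Borel sigma-algebra. *)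
Fact measure_rV_display : measure_display.
Proof. exact: default_measure_display. Qed.

Section rV_measurable.
Context {R : realType} {n : nat}.

Definition rV_cylinder : set (set 'rV[R]_n) :=
  [set A | exists (i : 'I_n) (B : set R),
     measurable B /\ A = [set x : 'rV[R]_n | B (x ord0 i)]].

Let rV_set0 : <<s rV_cylinder >> set0.
Proof. exact: sigma_algebra0. Qed.

Let rV_setC A : <<s rV_cylinder >> A -> <<s rV_cylinder >> (~` A).
Proof. exact: sigma_algebraC. Qed.

Let rV_bigcup (F : (set 'rV[R]_n)^nat) : (forall i, <<s rV_cylinder >> (F i)) ->
  <<s rV_cylinder >> (\bigcup_i (F i)).
Proof. exact: sigma_algebra_bigcup. Qed.

HB.instance Definition _ := @isMeasurable.Build measure_rV_display
  'rV[R]_n <<s rV_cylinder >> rV_set0 rV_setC rV_bigcup.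

Lemma measurable_coord (i : 'I_n) :
  measurable_fun [set: 'rV[R]_n] (fun x : 'rV[R]_n => x ord0 i).
Proof.
move=> _ Y mY; rewrite setTI; apply: sub_sigma_algebra.
by exists i, Y.
Qed.

Lemma measurable_fun_rV d (T : measurableType d) (D : set T) (f : T -> 'rV[R]_n) :
  (forall i, measurable_fun D (fun x => f x ord0 i)) -> measurable_fun D f.
Proof.
move=> mf mD; apply: (measurability rV_cylinder) => //.
by move=> _ [_ [i [B [mB ->]]] <-]; exact: (mf i mD B mB).
Qed.
End rV_measurable.

(* In the library the SigmaFiniteMeasure instance of a product is shadowed by its
   subprobability instance. *)
Lemma product_sigma_finite d1 d2 (T1 : measurableType d1)
    (T2 : measurableType d2) (R : realType)
    (m1 : {sigma_finite_measure set T1 -> \bar R})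
    (m2 : {sigma_finite_measure set T2 -> \bar R}) :
  sigma_finite setT (m1 \x m2)%E.
Proof.
have /sigma_finiteP[F [TF ndF Foo]] := sigma_finiteT m1.
have /sigma_finiteP[G [TG ndG Goo]] := sigma_finiteT m2.
exists (fun n => F n `*` G n).
  rewrite -setXTT TF TG predeqE => -[x y]; split.
    move=> [/= [n _ Fnx] [k _ Gky]]; exists (maxn n k) => //; split.
    - by move: x Fnx; exact/subsetPset/ndF/leq_maxl.
    - by move: y Gky; exact/subsetPset/ndG/leq_maxr.
  by move=> [n _ []/= ? ?]; split; exists n.
move=> k; have [? ?] := Foo k; have [? ?] := Goo k.
split; first exact: measurableX.
by rewrite product_measure1E// lte_mul_pinfty// ge0_fin_numE.
Qed.

Section lebesgue_rV.
Context {R : realType}.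

(* lebesgue_measure lives on measurableTypeR R; this is the same function, seen
   on the carrier R, which also has the normed structure. *)
Definition lebesgue_R : set R -> \bar R := @lebesgue_measure R.
HB.instance Definition _ := @isMeasure.Build default_measure_display R R
  lebesgue_R (@measure0 _ _ _ (@lebesgue_measure R))
  (@measure_ge0 _ _ _ (@lebesgue_measure R))
  (@measure_semi_sigma_additive _ _ _ (@lebesgue_measure R)).
HB.instance Definition _ := @Measure_isSigmaFinite.Build default_measure_display
  R R lebesgue_R (@sigma_finiteT _ _ _ (@lebesgue_measure R)).

Definition cons_rV n (p : R * 'rV[R]_n) : 'rV[R]_n.+1 :=
  \row_i oapp (p.2 ord0) p.1 (unlift ord0 i).

Definition uncons_rV n (x : 'rV[R]_n.+1) : R * 'rV[R]_n :=
  (x ord0 ord0, \row_i x ord0 (lift ord0 i)).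

Lemma cons_rVK n : cancel (@cons_rV n) (@uncons_rV n).
Proof.
move=> [a x]; congr pair; first by rewrite mxE unlift_none.
by apply/rowP => i; rewrite !mxE liftK.
Qed.

Lemma measurable_cons_rV n : measurable_fun setT (@cons_rV n).
Proof.
apply: measurable_fun_rV => i; case: (unliftP ord0 i) => [j|] ->.
  under eq_fun do rewrite mxE liftK /=.
  exact: (measurableT_comp (measurable_coord j) measurable_snd).
under eq_fun do rewrite mxE unlift_none /=; exact: measurable_fst.
Qed.

Lemma measurable_uncons_rV n : measurable_fun setT (@uncons_rV n).
Proof.
apply/measurable_fun_pairP; split; first exact: measurable_coord.
apply: measurable_fun_rV => i.
under eq_fun do rewrite mxE; exact: measurable_coord.
Qed.
HB.instance Definition _ n :=
  isMeasurableFun.Build _ _ _ _ (@cons_rV n) (@measurable_cons_rV n).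

Section step.
Context (n : nat) (mu : {sigma_finite_measure set 'rV[R]_n -> \bar R}).

Definition lebesgue_rV_step : set 'rV[R]_n.+1 -> \bar R :=
  pushforward (lebesgue_R \x mu)%E (@cons_rV n).

Let mcons (B : set 'rV[R]_n.+1) : measurable B -> measurable (@cons_rV n @^-1` B).
Proof. by move=> mB; rewrite -[X in measurable X]setTI; exact: measurable_cons_rV. Qed.

Let step0 : lebesgue_rV_step set0 = 0%E.
Proof. by rewrite /lebesgue_rV_step /pushforward preimage_set0 measure0. Qed.

Let step_ge0 A : (0 <= lebesgue_rV_step A)%E.
Proof. by rewrite /lebesgue_rV_step /pushforward; exact: measure_ge0. Qed.

Let step_sigma_additive : semi_sigma_additive lebesgue_rV_step.
Proof.
move=> F mF tF mUF; rewrite /lebesgue_rV_step /pushforward preimage_bigcup.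
apply: measure_semi_sigma_additive.
- by move=> k; exact: mcons.
- apply/trivIsetP => i j _ _ ij; rewrite -preimage_setI.
  by move/trivIsetP : tF => /(_ _ _ _ _ ij) ->//; rewrite preimage_set0.
- by rewrite -preimage_bigcup; exact: mcons.
Qed.

HB.instance Definition _ := isMeasure.Build _ _ _ lebesgue_rV_step
  step0 step_ge0 step_sigma_additive.

Let sigma_finite_step : sigma_finite setT lebesgue_rV_step.
Proof.
have [F FT mF] := product_sigma_finite lebesgue_R mu.
exists (fun k => @uncons_rV n @^-1` F k).
  by rewrite -preimage_bigcup -FT.
move=> k; have [mFk Fk] := mF k; split.
  by rewrite -[X in measurable X]setTI; exact: measurable_uncons_rV.
rewrite /lebesgue_rV_step /pushforward -comp_preimage.
by rewrite (_ : _ \o _ = id)//; apply/funext => p; exact: cons_rVK.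
Qed.
HB.instance Definition _ :=
  Measure_isSigmaFinite.Build _ _ _ lebesgue_rV_step sigma_finite_step.
End step.

Fixpoint lebesgue_rV n : {sigma_finite_measure set 'rV[R]_n -> \bar R} :=
  if n is n'.+1 then lebesgue_rV_step (lebesgue_rV n')
  else dirac (0 : 'rV[R]_0).

Lemma measurable_box n (A : 'I_n -> set R) : (forall i, measurable (A i)) ->
  measurable [set x : 'rV[R]_n | forall i, A i (x ord0 i)].
Proof.
move=> mA; rewrite (_ : mkset _ =
    \bigcap_(i in [set: 'I_n]) ((fun x : 'rV[R]_n => x ord0 i) @^-1` A i)).
  apply: fin_bigcap_measurable; first exact: (@finite_finset 'I_n).
  by move=> i _; rewrite -[X in measurable X]setTI; exact: measurable_coord.
by apply/seteqP; split=> x /= xA i; [move=> _|]; exact: xA.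
Qed.

Lemma lebesgue_rV_box n (A : 'I_n -> set R) : (forall i, measurable (A i)) ->
  lebesgue_rV n [set x | forall i, A i (x ord0 i)] =
  (\prod_(i < n) lebesgue_R (A i))%E.
Proof.
elim: n A => [|n IH] A mA.
  by rewrite big_ord0 /= /dirac indicE mem_set//= => -[].
rewrite big_ord_recl -IH; last by move=> i; exact: mA.
rewrite -product_measure1E//; last first.
  by apply: (measurable_box (A := fun i => A (lift ord0 i))) => i; exact: mA.
congr ((lebesgue_R \x _)%E _); apply/seteqP; split=> [[a x] /= Aax|[a x] /= [Aa Ax] i].
  split=> [|i]; first by have := Aax ord0; rewrite mxE unlift_none.
  by have := Aax (lift ord0 i); rewrite mxE liftK.
by rewrite mxE; case: (unliftP ord0 i) => [j|] ->.
Qed.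

End lebesgue_rV.
Lemma measurable_ball_spacetime (R : realType) n (z : 'rV[R]_n * R) (e : R) :
  0 < e -> measurable (ball z e).
Proof.
move=> e0; rewrite (_ : ball z e =
  [set x : 'rV[R]_n | forall i, ball (z.1 ord0 i) e (x ord0 i)] `*` ball z.2 e).
  apply: measurableX; last exact: measurable_ball.
  by apply: (measurable_box (A := fun i => ball (z.1 ord0 i) e)) => i; exact: measurable_ball.
apply/seteqP; split=> y /= [].
  by move=> [_ zy1] zy2; split=> // i; exact: zy1.
by move=> zy1 zy2; split=> //; split=> // i j; rewrite (ord1 i); exact: zy1.
Qed.

(* Missing join of the library, needed for compact_cover. *)
HB.instance Definition _ (T U : ptopologicalType) := Pointed.on (T * U)%type.

Lemma compact_measurable (R : realType) n (K : set ('rV[R]_n * R)) :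
  compact K -> measurable K.
Proof.
move=> cK; have := cK; rewrite (@compact_cover ('rV[R]_n * R)%type) => /(_ ('rV[R]_n * R)%type K) cov.
have /choice[F FK] k : exists D : {fset ('rV[R]_n * R)%type},
    [set` D] `<=` K /\ K `<=` \bigcup_(z in [set` D]) ball z k.+1%:R^-1.
  have [z Kz|z Kz|D DK KD] := cov (fun z => (ball z k.+1%:R^-1)).
  - exact: ball_open.
  - by exists z => //; exact: ballxx.
  - by exists D; split=> // z /= zD; exact: (set_mem (DK _ zD)).
rewrite (_ : K = \bigcap_k \bigcup_(z in [set` F k]) ball z k.+1%:R^-1).
  apply: bigcapT_measurable => k; apply: fin_bigcup_measurable => // z _.
  exact: measurable_ball_spacetime.
apply/seteqP; split=> [y Ky k _|y Fy]; first exact: (FK k).2.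
have /closure_id -> : closed K by apply: compact_closed => //; exact: norm_hausdorff.
move=> B /nbhs_ballP[e /= e0 eB].
have [k _ /(_ k (leqnn k)) ke] := near_infty_natSinv_lt (PosNum e0).
have [z zF zy] := Fy k Logic.I.
exists z; split; first exact: (FK k).1.
by apply: eB; apply: ball_sym; apply: le_ball zy; exact: ltW.
Qed.

Section spacetime.
Context {R : realType} (n : nat).

Definition lebesgue_spacetime : set ('rV[R]_n * R) -> \bar R :=
  (lebesgue_rV n \x lebesgue_R)%E.
HB.instance Definition _ := Measure.on lebesgue_spacetime.
HB.instance Definition _ := Measure_isSigmaFinite.Build _ _ _
  lebesgue_spacetime (product_sigma_finite (lebesgue_rV n) lebesgue_R).

End spacetime.
Arguments lebesgue_spacetime {R n}.

(* L_2(X) for a compact X; its elements coerce to functions on the whole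
   space-time, meaningful almost everywhere on X. *)
Notation L2_data cX :=
  (L2 (mrestr lebesgue_spacetime (compact_measurable cX))).

Section test_functions.
Context {R : realType} {V : normedModType R}.

Fixpoint Ck (k : nat) (f : V -> R) : Prop :=
  continuous f /\
  if k is k'.+1 then
    forall v, (forall x, derivable f x v) /\ Ck k' ('D_v f)
  else True.

Definition test_function (O : set V) (eta : V -> R) :=
  (forall k, Ck k eta) /\
  exists2 K, compact K & K `<=` O /\ forall x, ~ K x -> eta x = 0.

End test_functions.

Section wave_equation.
Context {R : realType} {n : nat}.
Local Notation space := 'rV[R]_n.
Local Notation spacetime := ('rV[R]_n * R)%type.
Local Notation lambda := (@lebesgue_spacetime R n).
Implicit Types (T s : R) (m rho : space -> R) (v vt f : spacetime -> R).

Definition dt : spacetime := (0, 1).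
Definition dx (i : 'I_n) : spacetime := (delta_mx ord0 i, 0).

Definition slab T : set spacetime := [set: space] `*` `[0, T].
Definition open_slab T : set spacetime := [set: space] `*` `]0, T[.

Definition L2_on (A : set spacetime) f := f \_ A \in Lfun lambda 2.

Definition locally_integrable_on (A : set spacetime) f :=
  forall K, compact K -> K `<=` A -> lambda.-integrable K (EFin \o f).

Definition coefficient (c : space -> R) :=
  measurable_fun setT c /\
  exists a b, 0 < a /\ forall x, a <= c x <= b.

Definition slice v (t : R) : space -> R := fun x => v (x, t).

Definition curve v (t : R) : L2 (lebesgue_rV n) :=
  L2_class (lebesgue_rV n) (slice v t).

Definition L2_continuous T v :=
  [/\ measurable_fun (slab T) v,
      forall t, t \in `[0, T] -> slice v t \in Lfun (lebesgue_rV n) 2 &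
      {within `[0, T], continuous (curve v)}].

(* One-sided at the endpoints 0 and T. *)
Definition L2_time_derivative T v vt :=
  forall t, t \in `[0, T] ->
    (fun s => (s - t)^-1 *: (curve v s - curve v t)) @ within `[0, T] t^'
      --> curve vt t.

Definition weak_gradient (w : space -> R) (G : 'I_n -> space -> R) :=
  forall (i : 'I_n) (chi : space -> R), test_function setT chi ->
    \int[lebesgue_rV n]_x (w x * 'D_(delta_mx ord0 i) chi x) =
    - \int[lebesgue_rV n]_x (G i x * chi x).

(* v in C([0,T]; H^1(R^n)) and C^1([0,T]; L_2(R^n)), with time derivative vt and
   spatial gradient G. *)
Definition finite_energy T v vt (G : 'I_n -> spacetime -> R) :=
  [/\ L2_continuous T v, L2_continuous T vt,
      forall i, L2_continuous T (G i),
      L2_time_derivative T v vt &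
      forall t, t \in `[0, T] ->
        weak_gradient (slice v t) (fun i => slice (G i) t)].

(* m v_tt - div (rho^-1 grad v) = f in the sense of distributions on
   R^n x ]0,T[. *)
Definition weak_wave_equation m rho T f vt (G : 'I_n -> spacetime -> R) :=
  forall eta, test_function (open_slab T) eta ->
    \int[lambda]_(z in slab T)
      (- (m z.1 * vt z * 'D_dt eta z) +
       (rho z.1)^-1 * \sum_(i < n) G i z * 'D_(dx i) eta z) =
    \int[lambda]_(z in slab T) (f z * eta z).

(* Finite-energy solution with Cauchy data (w0, w1) at time s: s = 0 for the
   forward problem, s = T for the terminal-value problem. *)
Definition wave_solution m rho T f s (w0 w1 : space -> R) v :=
  exists vt G,
    [/\ finite_energy T v vt G, weak_wave_equation m rho T f vt G,
        slice v s = w0 %[ae lebesgue_rV n] &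
        slice vt s = w1 %[ae lebesgue_rV n]].

Definition well_posed m rho T f s (w0 w1 : space -> R) :=
  exists2 v, wave_solution m rho T f s w0 w1 v &
    forall v', wave_solution m rho T f s w0 w1 v' ->
      v = v' %[ae lambda in slab T].

Definition weak_dtt T v (vtt : spacetime -> R) :=
  forall eta, test_function (open_slab T) eta ->
    \int[lambda]_(z in slab T) (v z * 'D_dt ('D_dt eta) z) =
    \int[lambda]_(z in slab T) (vtt z * eta z).

Definition adjoint_gradient T v (utt : spacetime -> R) (x : space) : R :=
  - \int[lebesgue_R]_(t in `[0, T]) (v (x, t) * utt (x, t)).

End wave_equation.

Definition path_connected (V : topologicalType) (U : set V) (R : realType) :=
  forall x y, U x -> U y -> exists gamma : R -> V,
    [/\ {within `[0, 1], continuous gamma}, gamma @` `[0, 1] `<=` U,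
        gamma 0 = x & gamma 1 = y].

Definition simply_connected (V : topologicalType) (U : set V) (R : realType) :=
  path_connected U R /\
  forall gamma : R -> V,
    {within `[0, 1], continuous gamma} -> gamma @` `[0, 1] `<=` U ->
    gamma 0 = gamma 1 ->
    exists H : R * R -> V,
      [/\ {within `[0, 1] `*` `[0, 1], continuous H},
          H @` (`[0, 1] `*` `[0, 1]) `<=` U,
          forall s, s \in `[0, 1] -> H (0, s) = gamma s /\ H (1, s) = gamma 0 &
          forall t, t \in `[0, 1] -> H (t, 0) = gamma 0 /\ H (t, 1) = gamma 0].

Section optimal_transport.
Context {R : realType} {n : nat}.
Local Notation spacetime := ('rV[R]_n * R)%type.
Local Notation lambda := (@lebesgue_spacetime R n).
Implicit Types (X : set spacetime) (mu nu phi psi : spacetime -> R).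

Definition data_domain (T : R) X :=
  X `<=` slab T /\
  exists U, [/\ open U, bounded_set U, U !=set0, simply_connected U R
    & X = closure U].

(* Absolutely continuous probability measures on X are represented by their
   densities. *)
Definition probability_density X mu :=
  [/\ measurable_fun X mu, {ae lambda, forall x, X x -> 0 <= mu x} &
      (\int[lambda]_(x in X) (mu x)%:E = 1)%E].

Definition class_U X mu :=
  probability_density X mu /\
  exists2 r : R, 0 < r & forall A, measurable A -> A `<=` X ->
    (r%:E * lambda A <= \int[lambda]_(x in A) (mu x)%:E)%E.

(* The norm of 'rV[R]_n * R is a sup norm; the cost is Euclidean. *)
Definition cost (x y : spacetime) : R :=
  2^-1 * (\sum_(i < n) (x.1 ord0 i - y.1 ord0 i) ^+ 2 + (x.2 - y.2) ^+ 2).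

Definition L1_density X mu phi :=
  measurable_fun X phi /\ lambda.-integrable X (fun x => (phi x * mu x)%:E).

Definition dual_admissible X mu nu phi psi :=
  [/\ L1_density X mu phi, L1_density X nu psi &
      forall x y, X x -> X y -> phi x + psi y <= cost x y].

Definition dual_value X mu nu phi psi : R :=
  \int[lambda]_(x in X) (phi x * mu x) + \int[lambda]_(x in X) (psi x * nu x).

Definition kantorovich_potential X mu nu phi :=
  exists2 psi, dual_admissible X mu nu phi psi &
    forall phi' psi', dual_admissible X mu nu phi' psi' ->
      dual_value X mu nu phi' psi' <= dual_value X mu nu phi psi.

(* The class in L_2(X) of the restriction of w to X. *)
Definition restrict_data X (cX : compact X) (w : spacetime -> R) : L2_data cX :=
  L2_class _ (w \_ X).

Definition extend_data X (cX : compact X) (w : L2_data cX) : spacetime -> R :=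
  (w : spacetime -> R) \_ X.

End optimal_transport.

Definition L2_adjoint d (S : measurableType d) (R : realType)
    (mu : {measure set S -> \bar R}) (A B : L2 mu -> L2 mu) :=
  forall f g, L2_dot (A f) g = L2_dot f (B g).

(* Main.v *)
Require Import Defs.
From HB Require Import structures.
From mathcomp Require Import all_boot all_order all_algebra generic_quotient.
From mathcomp Require Import finmap.
From mathcomp Require Import all_classical all_reals all_analysis.
From mathcomp Require Import measurable_realfun.
From mathcomp Require Import ring lra.
Set Implicit Arguments.
Unset Strict Implicit.
Unset Printing Implicit Defensive.
Import Order.TTheory GRing.Theory Num.Theory.
Import numFieldNormedType.Exports.
Local Open Scope classical_set_scope.
Local Open Scope ring_scope.

(* Two Kantorovich potentials agree up to a constant almost everywhere on X.  A
   potential [phi] paired with [psi] equals the c-transform of [psi] almost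
   everywhere, and the midpoint of two optimal pairs is again optimal; hence on
   the open set U the c-transform of the midpoint is the midpoint of the
   c-transforms.  Near-minimizers y(x) for the former are then near-minimizers for
   both, so the difference G of the two c-transforms satisfies
   |G x' - G x| <= <x' - x, y(x') - y(x)> + small.  Summing over a segment cut into
   N equal pieces telescopes to O(1/N): G is locally constant on U.  Neither an
   optimal plan nor differentiability of the potentials is used.

   Since D takes values of integral 1, the range of D' is orthogonal to the
   constants, so the adjoint of D' identifies the two potentials.  Both
   terminal-value problems thus have the same source, and well-posedness makes
   their solutions equal. *)

(** * The quadratic cost as an inner product, and its c-transforms *)

Section ctransform.
Context {R : realType} {n : nat}.
Local Notation spacetime := ('rV[R]_n * R)%type.
Implicit Types (X U : set spacetime) (x y z d : spacetime).
Implicit Types (phi psi : spacetime -> R).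

Definition dot x y : R := \sum_(i < n) x.1 ord0 i * y.1 ord0 i + x.2 * y.2.

Lemma dotC x y : dot x y = dot y x.
Proof. by rewrite /dot mulrC; congr (_ + _); apply: eq_bigr => i _; rewrite mulrC. Qed.

Lemma dotDl x y z : dot (x + y) z = dot x z + dot y z.
Proof.
rewrite /dot /= mulrDl addrACA -big_split /=; congr (_ + _).
by apply: eq_bigr => i _; rewrite mxE mulrDl.
Qed.

Lemma dotZl (a : R) x y : dot (a *: x) y = a * dot x y.
Proof.
rewrite /dot /= mulrDr mulr_sumr mulrA; congr (_ + _).
by apply: eq_bigr => i _; rewrite mxE mulrA.
Qed.

Lemma dotBl x y z : dot (x - y) z = dot x z - dot y z.
Proof. by rewrite -scaleN1r dotDl dotZl mulN1r. Qed.

Lemma dotDr x y z : dot x (y + z) = dot x y + dot x z.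
Proof. by rewrite dotC dotDl !(dotC x). Qed.

Lemma dotBr x y z : dot x (y - z) = dot x y - dot x z.
Proof. by rewrite dotC dotBl !(dotC x). Qed.

(** The norm is a maximum over coordinates, so each of the [n.+1] coordinate products is bounded by
    the product of the norms. *)
Lemma dot_norm_le x y : `|dot x y| <= n.+1%:R * `|x| * `|y|.
Proof.
have x2 (z : spacetime) : `|z.2| <= `|z| by rewrite prod_normE le_max lexx orbT.
have x1 (z : spacetime) i : `|z.1 ord0 i| <= `|z|.
  rewrite prod_normE le_max; apply/orP; left.
  rewrite [leRHS]/Num.norm /= mx_normrE.
  by apply/bigmax_geP; right => /=; exists (ord0, i).
rewrite (le_trans (ler_normD _ _))// -natr1 -mulrA mulrDl mul1r lerD//.
  rewrite (le_trans (ler_norm_sum _ _ _))//.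
  rewrite (@le_trans _ _ (\sum_(i < n) `|x| * `|y|))//.
    by apply: ler_sum => i _; rewrite normrM ler_pM.
  by rewrite sumr_const card_ord mulr_natl.
by rewrite normrM ler_pM.
Qed.

Lemma costE x y : cost x y = 2^-1 * dot (x - y) (x - y).
Proof.
rewrite /cost /dot /= expr2; congr (_ * (_ + _)).
by apply: eq_bigr => i _; rewrite !mxE expr2.
Qed.

Lemma costB x x' y : cost x' y - cost x y = 2^-1 * dot (x' - x) (x' + x - y - y).
Proof.
rewrite !costE !(dotBl, dotBr, dotDr) (dotC y x) (dotC y x') (dotC x' x); ring.
Qed.

(** Terms depending on one variable only cancel. What survives is the mixed part of the cost, which
    is bilinear; this makes the sum in [ctrans_sub_segment] telescope. *)
Lemma cost_cross x x' y y' :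
  (cost x' y - cost x y) - (cost x' y' - cost x y') = dot (x' - x) (y' - y).
Proof.
by rewrite !costB !(dotBl, dotBr, dotDr); field.
Qed.

(* The c-transform; [inf] is junk on sets unbounded below, which admissibility of
   some pair (phi, psi) excludes. *)
Definition ctrans X psi x : R := inf [set cost x y - psi y | y in X].

(** * Regularity of a single c-transform *)

Section fixed_pair.
Context (X : set spacetime) (phi psi : spacetime -> R) (x0 : spacetime).
Context (Xx0 : X x0)
  (adm : forall x y, X x -> X y -> phi x + psi y <= cost x y).

Lemma ctrans_has_inf x : X x -> has_inf [set cost x y - psi y | y in X].
Proof.
move=> Xx; split; first by exists (cost x x0 - psi x0); exists x0.
by exists (phi x) => _ [y Xy <-]; rewrite lerBrDr adm.
Qed.

Lemma ctrans_admissible x y : X x -> X y -> ctrans X psi x + psi y <= cost x y.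
Proof.
move=> Xx Xy; rewrite -lerBrDr; apply: ge_inf; last by exists y.
by have [] := ctrans_has_inf Xx.
Qed.

Lemma ctrans_ge x (a : R) : X x -> (forall y, X y -> a + psi y <= cost x y) ->
  a <= ctrans X psi x.
Proof.
move=> Xx h; apply: lb_le_inf; first by have [] := ctrans_has_inf Xx.
by move=> _ [y Xy <-]; rewrite lerBrDr h.
Qed.

Lemma ctrans_adherent x (e : R) : X x -> 0 < e ->
  exists2 y, X y & cost x y - psi y < ctrans X psi x + e.
Proof.
move=> Xx e0; have [_ [y Xy <-] ye] := inf_adherent e0 (ctrans_has_inf Xx).
by exists y.
Qed.

(** An infimum of functions with a common Lipschitz constant inherits it. The constant comes from
    [costB]: one half times [n.+1] times the bound [4 * M] on [x' + x - y - y]. *)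
Lemma ctrans_lipschitz (M : R) : (forall x, X x -> `|x| <= M) ->
  forall x x', X x -> X x' ->
  `|ctrans X psi x' - ctrans X psi x| <= 2 * n.+1%:R * M * `|x' - x|.
Proof.
move=> XM.
have cost_lip x x' y : X x -> X x' -> X y ->
    cost x' y - cost x y <= 2 * n.+1%:R * M * `|x' - x|.
  move=> Xx Xx' Xy; rewrite costB.
  apply: (le_trans (ler_norm _)); rewrite normrM ger0_norm//.
  have h := dot_norm_le (x' - x) (x' + x - y - y).
  have h' : `|x' + x - y - y| <= 4 * M.
    have -> : 4 * M = M + M + M + M by ring.
    rewrite (le_trans (ler_normB _ _))// lerD ?XM//.
    rewrite (le_trans (ler_normB _ _))// lerD ?XM//.
    by rewrite (le_trans (ler_normD _ _))// lerD ?XM.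
  have h2 : n.+1%:R * `|x' - x| * `|x' + x - y - y| <= n.+1%:R * `|x' - x| * (4 * M).
    by rewrite ler_wpM2l// mulr_ge0.
  rewrite mulrC ler_pdivrMr// (le_trans h)// (le_trans h2)//.
  by rewrite le_eqVlt; apply/orP; left; apply/eqP; ring.
have half x x' : X x -> X x' ->
    ctrans X psi x' - ctrans X psi x <= 2 * n.+1%:R * M * `|x' - x|.
  move=> Xx Xx'; rewrite lerBlDr addrC -lerBlDr; apply: ctrans_ge => // y Xy.
  have := ctrans_admissible Xx' Xy; have := cost_lip _ _ _ Xx Xx' Xy; lra.
move=> x x' Xx Xx'; rewrite ler_norml half// andbT lerNl opprB distrC.
exact: half.
Qed.

Lemma ctrans_bounded (M : R) : (forall x, X x -> `|x| <= M) ->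
  exists B : R, forall x, X x -> `|ctrans X psi x| <= B.
Proof.
move=> XM; exists (`|ctrans X psi x0| + 2 * n.+1%:R * M * (M + M)) => x Xx.
have M0 : 0 <= M by rewrite (le_trans _ (XM _ Xx)).
rewrite -[ctrans X psi x](subrK (ctrans X psi x0)) (le_trans (ler_normD _ _))//.
rewrite addrC lerD2l (le_trans (ctrans_lipschitz XM Xx0 Xx))//.
by rewrite ler_wpM2l ?mulr_ge0// (le_trans (ler_normB _ _))// lerD ?XM.
Qed.

End fixed_pair.

(** * Comparison of two c-transforms through their midpoint *)

Section midpoint.
Context (X : set spacetime) (phi0 psi0 phi1 psi1 : spacetime -> R).
Context (adm0 : forall x y, X x -> X y -> phi0 x + psi0 y <= cost x y)
  (adm1 : forall x y, X x -> X y -> phi1 x + psi1 y <= cost x y).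

Definition midpoint (f g : spacetime -> R) : spacetime -> R :=
  fun x => 2^-1 * (f x + g x).

Lemma midpoint_admissible x y : X x -> X y ->
  midpoint phi0 phi1 x + midpoint psi0 psi1 y <= cost x y.
Proof.
move=> Xx Xy; have := adm0 Xx Xy; have := adm1 Xx Xy; rewrite /midpoint; lra.
Qed.

Local Notation p0 := (ctrans X psi0).
Local Notation p1 := (ctrans X psi1).

(* Where the c-transform of the midpoint is the midpoint of the c-transforms,
   almost minimizers of the former almost minimize both of the latter. *)
Lemma common_adherent x (e : R) : X x ->
  ctrans X (midpoint psi0 psi1) x = midpoint p0 p1 x -> 0 < e ->
  exists y, [/\ X y, cost x y - psi0 y < p0 x + e & cost x y - psi1 y < p1 x + e].
Proof.
move=> Xx mid e0.
(* The two excesses over the infima are nonnegative and their average is below [e / 2], so each is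
   below [e]. *)
have e2 : 0 < e / 2 by rewrite divr_gt0.
have [y Xy hy] := ctrans_adherent Xx midpoint_admissible Xx e2.
exists y; have := ctrans_admissible Xx adm0 Xx Xy.
have := ctrans_admissible Xx adm1 Xx Xy.
by move: hy; rewrite mid /midpoint => h h1 h0; split => //; lra.
Qed.

Lemma ctrans_sub_segment (M : R) x d : (forall x, X x -> `|x| <= M) ->
  (forall t, 0 <= t <= 1 -> X (x + t *: d) /\
    ctrans X (midpoint psi0 psi1) (x + t *: d) = midpoint p0 p1 (x + t *: d)) ->
  p0 (x + d) - p1 (x + d) = p0 x - p1 x.
Proof.
move=> XM seg.
(* The first summand bounds the telescoped inner product; the accumulated errors contribute 2, for
   which 4 leaves room. *)
pose C : R := n.+1%:R * `|d| * (M + M) + 4.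
suff bnd N : `|(p0 (x + d) - p1 (x + d)) - (p0 x - p1 x)| <= C / N.+1%:R.
  apply/eqP; rewrite -subr_eq0 -normr_le0; apply/ler_addgt0Pl => e e0.
  rewrite addr0; have [N _ /(_ N (leqnn N)) hN] :=
    near_infty_natSinv_lt (PosNum (divr_gt0 e0 (ltr_pwDl ltr01 (normr_ge0 C)))).
  rewrite (le_trans (bnd N))// ltW//.
  rewrite (@le_lt_trans _ _ ((1 + `|C|) * N.+1%:R^-1))//.
    by rewrite ler_pM2r ?invr_gt0// (le_trans (ler_norm _))// lerDr.
  rewrite mulrC -ltr_pdivlMr//; exact: ltr_pwDl.
pose h : R := N.+1%:R^-1.
have h0 : 0 < h by rewrite invr_gt0.
have Nh : N.+1%:R * h = 1 by rewrite divff.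
pose xk (k : nat) := x + (k%:R * h) *: d.
have kh k : (k <= N.+1)%N -> 0 <= k%:R * h <= 1.
  by move=> kN; rewrite mulr_ge0 ?(ltW h0)//= ler_pdivrMr// mul1r ler_nat.
have h20 : 0 < h ^+ 2 by rewrite exprn_gt0.
(* Precision [h ^+ 2] keeps the total error over [N.+1] steps at [2 * h]. Beyond [N.+1] the chosen
   value is arbitrary. *)
have ex k : exists y, (k <= N.+1)%N ->
    [/\ X y, cost (xk k) y - psi0 y < p0 (xk k) + h ^+ 2
      & cost (xk k) y - psi1 y < p1 (xk k) + h ^+ 2].
  have [kN|] := leqP k N.+1; last by exists x.
  have [Xk mid] := seg _ (kh _ kN).
  by have [y ?] := common_adherent Xk mid h20; exists y.
have [y yP] := choice ex.
pose G z := p0 z - p1 z.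
(* Testing [p0] at the new point with the old [y k] bounds its increment above; testing [p1] at the
   old point with the new [y k.+1] bounds its increment below. The difference is the mixed
   difference of [cost_cross]. Exchanging [p0] and [p1] gives the other sign. *)
have step k : (k < N.+1)%N ->
    `|G (xk k.+1) - G (xk k)| <= h * dot d (y k.+1 - y k) + 2 * h ^+ 2.
  move=> kN; have [Xy a0 a1] := yP _ (ltnW kN); have [Xy' a0' a1'] := yP _ kN.
  have [Xx _] := seg _ (kh _ (ltnW kN)); have [Xx' _] := seg _ (kh _ kN).
  have b0 := ctrans_admissible Xx adm0 Xx' Xy.
  have b1 := ctrans_admissible Xx adm1 Xx' Xy.
  have b0' := ctrans_admissible Xx adm0 Xx Xy'.
  have b1' := ctrans_admissible Xx adm1 Xx Xy'.
  have := cost_cross (xk k) (xk k.+1) (y k) (y k.+1).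
  have -> : xk k.+1 - xk k = h *: d.
    rewrite /xk opprD addrACA subrr add0r -scalerBl -mulrBl -natrB ?leqnSn//.
    by rewrite subSnn mul1r.
  rewrite dotZl -/(xk k) -/(xk k.+1) in b0 b1 b0' b1' * => cr.
  rewrite /G ler_norml; apply/andP; split; lra.
have tele k : (k <= N.+1)%N ->
    `|G (xk k) - G (xk 0)| <= h * dot d (y k - y 0) + 2 * k%:R * h ^+ 2.
  elim: k => [_|k IH kN]; first by rewrite dotBr !subrr normr0; lra.
  have := IH (ltnW kN); have := step _ kN.
  have := ler_normD (G (xk k.+1) - G (xk k)) (G (xk k) - G (xk 0)).
  rewrite addrA subrK !dotBr -natr1; lra.
have := tele _ (leqnn _).
have -> : xk 0 = x by rewrite /xk mul0r scale0r addr0.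
have -> : xk N.+1 = x + d by rewrite /xk Nh scale1r.
have [Xy0 _ _] := yP 0%N (leq0n _); have [XyN _ _] := yP _ (leqnn N.+1).
move=> /le_trans -> //.
have dn := le_trans (ler_norm _) (dot_norm_le d (y N.+1 - y 0)).
have yy : `|y N.+1 - y 0| <= M + M.
  by rewrite (le_trans (ler_normB _ _))// lerD ?XM.
have -> : 2 * N.+1%:R * h ^+ 2 = 2 * h by rewrite expr2 -mulrA (mulrA _ h) Nh mul1r.
rewrite /C -/h mulrC -mulrDl ler_wpM2r ?(ltW h0)//.
have : n.+1%:R * `|d| * `|y N.+1 - y 0| <= n.+1%:R * `|d| * (M + M).
  by rewrite ler_wpM2l// mulr_ge0.
lra.
Qed.

(** A ball inside [U] contains the segments from its centre, so the difference is constant on it;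
    connectedness of a path carries the value from [x] to [y]. *)
Lemma ctrans_sub_cst_open (M : R) U : (forall x, X x -> `|x| <= M) ->
  open U -> U `<=` X -> path_connected U R ->
  (forall x, U x -> ctrans X (midpoint psi0 psi1) x = midpoint p0 p1 x) ->
  forall x y, U x -> U y -> p0 x - p1 x = p0 y - p1 y.
Proof.
move=> XM oU UX cU mid.
pose G z := p0 z - p1 z.
have loc x : U x -> \forall y \near x, U y /\ G y = G x.
  move=> Ux; have /nbhs_ballP[e /= e0 eU] : nbhs x U by exact: open_nbhs_nbhs.
  apply/nbhs_ballP; exists e => //= y xy; split; first exact: eU.
  have := @ctrans_sub_segment M x (y - x) XM; rewrite subrKC; apply.
  move=> t /andP[t0 t1]; have Ut : U (x + t *: (y - x)).
    apply: eU; move: xy; rewrite -ball_normE /= opprD addrA subrr add0r normrN.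
    rewrite normrZ ger0_norm// distrC; apply: le_lt_trans.
    by rewrite ler_piMl.
  by split; [exact: UX | exact: mid].
move=> x y Ux Uy; have [g [cg gU g0 g1]] := cU x y Ux Uy.
pose I := g @` `[0, 1].
have cI : connected I.
  by apply: connected_continuous_connected => //; exact: segment_connected.
have I0 : I x by exists 0 => //=; rewrite in_itv /= lexx ler01.
have I1 : I y by exists 1 => //=; rewrite in_itv /= lexx ler01.
(* Local constancy makes [V a] open for every predicate [a]. Taking equality with [G x] and its
   negation, the level set is both open and closed in the path. *)
pose V (a : R -> Prop) := [set z | U z /\ a (G z)].
have oV a : open (V a).
  by move=> z [Uz az]; apply: filterS (loc _ Uz) => w [Uw Gw]; split=> //; rewrite Gw.
have IE : I `&` V (fun r => r = G x) = I.
  apply: cI.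
  - by exists x; split=> //; split.
  - by exists (V (fun r => r = G x)).
  - exists (~` V (fun r => r <> G x)); first exact: open_closedC.
    apply/seteqP; split=> z [Iz]; first by move=> [_ e]; split=> // -[_ /(_ e)].
    move=> nz; split=> //; split; first exact: gU.
    by apply: contrapT => ne; apply: nz; split => //; exact: gU.
by move: I1; rewrite -IE => -[_ [_]].
Qed.

Lemma ctrans_sub_cst (M : R) U x0 : (forall x, X x -> `|x| <= M) ->
  open U -> U `<=` X -> X `<=` closure U -> path_connected U R -> U x0 ->
  (forall x, U x -> ctrans X (midpoint psi0 psi1) x = midpoint p0 p1 x) ->
  forall x, X x -> p0 x - p1 x = p0 x0 - p1 x0.
Proof.
move=> XM oU UX XU cU Ux0 mid x Xx.
have M0 : 0 <= M by rewrite (le_trans _ (XM _ Xx)).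
pose L := 2 * n.+1%:R * M.
have L0 : 0 <= L by rewrite !mulr_ge0.
apply/eqP; rewrite -subr_eq0 -normr_le0; apply/ler_addgt0Pl => e e0; rewrite addr0.
(* Each c-transform contributes [L] to the Lipschitz constant of the difference; the added 1 keeps
   the denominator positive when [L] is 0. *)
have d0 : 0 < e / (2 * L + 1) by rewrite divr_gt0// ltr_pwDr// mulr_ge0.
have [y [Uy xy]] := XU _ Xx _ (nbhsx_ballx x _ d0).
rewrite -(ctrans_sub_cst_open XM oU UX cU mid Uy Ux0).
have a0 := ctrans_lipschitz Xx adm0 XM (UX _ Uy) Xx.
have a1 := ctrans_lipschitz Xx adm1 XM (UX _ Uy) Xx.
have /= : `|x - y| < e / (2 * L + 1) by move: xy; rewrite -ball_normE.
rewrite ltr_pdivlMr; last by rewrite ltr_pwDr// mulr_ge0.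
move=> lt; have := ler_normB (p0 x - p0 y) (p1 x - p1 y).
have -> : p0 x - p0 y - (p1 x - p1 y) = p0 x - p1 x - (p0 y - p1 y) by ring.
rewrite -/L in a0 a1; have := normr_ge0 (x - y); nra.
Qed.

End midpoint.
End ctransform.

(** * Optimal pairs and uniqueness of Kantorovich potentials up to a constant *)

Section kantorovich_potentials.
Context {R : realType} {n : nat}.
Local Notation spacetime := ('rV[R]_n * R)%type.
Local Notation lambda := (@lebesgue_spacetime R n).
Implicit Types (X U : set spacetime) (mu nu phi psi : spacetime -> R).

Lemma continuous_costl (y : spacetime) : continuous (cost^~ y).
Proof.
have csqr (f : spacetime -> R) (c : R) : continuous f ->
    continuous (fun x => (f x - c) ^+ 2).
  move=> cf x; apply: (@continuous_comp _ _ _ (fun x => f x - c) (fun a : R => a ^+ 2)).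
    by apply: cvgB; [exact: cf | exact: cvg_cst].
  exact: exprn_continuous.
move=> x; apply: cvgM; first exact: cvg_cst.
apply: cvgD; last by apply: csqr => z; exact: cvg_snd.
move: x; apply: continuous_big => [|i _]; first exact: add_continuous.
apply: csqr => z; apply: (@continuous_comp _ _ _ fst (fun w : 'rV[R]_n => w ord0 i)).
  exact: cvg_fst.
exact: coord_continuous.
Qed.

(** Balls of the sup norm are boxes, so the measure is a product of interval lengths. Consequently a
    property true almost everywhere holds somewhere in every ball. *)
Lemma lebesgue_spacetime_ball_gt0 (z : spacetime) (e : R) : 0 < e ->
  (0 < lambda (ball z e))%E.
Proof.
move=> e0; rewrite (_ : ball z e =
  [set x : 'rV[R]_n | forall i, ball (z.1 ord0 i) e (x ord0 i)] `*` ball z.2 e).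
  have be (a : R) : (0 < lebesgue_R (ball a e))%E.
    by rewrite /lebesgue_R lebesgue_measure_ball ?ltW// lte_fin mulrn_wgt0.
  rewrite /lebesgue_spacetime product_measure1E; last exact: measurable_ball.
    rewrite mule_gt0 ?be//.
    rewrite [X in (_ < X)%E](lebesgue_rV_box (A := fun i => ball (z.1 ord0 i) e)).
      apply: (big_ind (fun a => 0 < a)%E) => [|a b|i _]; first exact: lte01.
        exact: mule_gt0.
      exact: be.
    by move=> i; exact: measurable_ball.
  by apply: (measurable_box (A := fun i => ball (z.1 ord0 i) e)) => i; exact: measurable_ball.
apply/seteqP; split=> y /= [].
  by move=> [_ zy1] zy2; split=> // i; exact: zy1.
by move=> zy1 zy2; split=> //; split=> // i j; rewrite (ord1 i); exact: zy1.
Qed.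

(** On the part [A] of [X] where [mu] is at most 0, the lower bound [r] times the measure of [A] is
    at most a nonpositive integral, so [A] is null. *)
Lemma class_U_gt0 X mu : measurable X -> class_U X mu ->
  {ae lambda, forall x, X x -> 0 < mu x}.
Proof.
move=> mX [[mmu _ _] [r r0 rmu]].
pose A := X `&` mu @^-1` `]-oo, 0].
have mA : measurable A by exact: mmu.
exists A; split=> // [|x nx]; last first.
  have [Xx mux] : X x /\ ~ 0 < mu x by apply/not_implyP.
  by split=> //=; rewrite in_itv /= leNgt; apply/negP.
have := rmu _ mA (@subIsetl _ _ _).
have le0 : (\int[lambda]_(x in A) (mu x)%:E <= 0)%E.
  have mu_le0 x : A x -> (0 <= - (mu x)%:E)%E.
    by move=> [_ /=]; rewrite in_itv /= lee_fin oppr_ge0.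
  under eq_integral do rewrite -(oppeK (mu _)%:E).
  by rewrite integral_ge0N// oppe_le0 integral_ge0.
move=> /le_trans /(_ le0) h; apply/eqP; rewrite eq_le measure_ge0 andbT.
by move: h; rewrite pmule_rle0.
Qed.

Lemma density_integrable X mu : measurable X -> probability_density X mu ->
  lambda.-integrable X (EFin \o mu).
Proof.
move=> mX [mmu mu0 mu1]; apply/integrableP; split; first exact/measurable_EFinP.
rewrite (_ : (\int[_]_(x in X) _ = 1)%E) ?ltry// -mu1; apply: ae_eq_integral => //.
- by apply: measurableT_comp => //; exact/measurable_EFinP.
- exact/measurable_EFinP.
by apply: filterS mu0 => x h Xx /=; rewrite ger0_norm ?h.
Qed.

(** An infimum of continuous functions is upper semicontinuous: its superlevel sets are
    intersections of closed sets with the compact [X]. *)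
Lemma measurable_ctrans X (psi phi : spacetime -> R) : compact X ->
  (forall x y, X x -> X y -> phi x + psi y <= cost x y) ->
  measurable_fun X (ctrans X psi).
Proof.
move=> cX adm; apply: (measurability (@RGenCInfty.G R)) => [|/= _ [_] [r] -> <-].
  exact: RGenCInfty.measurableE.
rewrite (_ : _ `&` _ = X `&` \bigcap_(y in X) [set x | r + psi y <= cost x y]).
  apply: Defs.compact_measurable; apply: compact_closedI => //.
  have cl y : X y -> closed [set x | r + psi y <= cost x y].
    move=> _; apply: (@preimage_closed _ _ (cost^~ y) [set a : R | r + psi y <= a]).
      by move=> x _; exact: continuous_costl.
    exact: closed_ge.
  exact: (closed_bigI cl).
apply/seteqP; split=> x [Xx /=]; rewrite in_itv /= andbT => h; split=> //.
  move=> y Xy /=; apply: le_trans (ctrans_admissible Xx adm Xx Xy); by rewrite lerD2r.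
exact: (ctrans_ge Xx adm).
Qed.

(** Exposes the second component, existentially quantified in [kantorovich_potential], so that pairs
    can be averaged. *)
Definition optimal_pair X mu nu phi psi :=
  dual_admissible X mu nu phi psi /\
  forall phi' psi', dual_admissible X mu nu phi' psi' ->
    dual_value X mu nu phi' psi' <= dual_value X mu nu phi psi.

(** The constraints are convex and the dual value is linear, so maximizers form a convex set. *)
Lemma optimal_midpoint X mu nu phi0 psi0 phi1 psi1 : measurable X ->
  optimal_pair X mu nu phi0 psi0 -> optimal_pair X mu nu phi1 psi1 ->
  optimal_pair X mu nu (midpoint phi0 phi1) (midpoint psi0 psi1).
Proof.
move=> mX [a0 max0] [a1 max1].
have [[mphi0 iphi0] [mpsi0 ipsi0] adm0] := a0.
have [[mphi1 iphi1] [mpsi1 ipsi1] adm1] := a1.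
have midM (f g h : spacetime -> R) :
    (fun x => midpoint f g x * h x) = (fun x => 2^-1 * (f x * h x + g x * h x)).
  by apply/funext => x; rewrite /midpoint; ring.
have mmid (f g : spacetime -> R) : measurable_fun X f -> measurable_fun X g ->
    measurable_fun X (midpoint f g).
  by move=> mf mg; apply: measurable_funM => //; exact: measurable_funD.
have imid (f g h : spacetime -> R) :
    lambda.-integrable X (fun x => (f x * h x)%:E) ->
    lambda.-integrable X (fun x => (g x * h x)%:E) ->
    lambda.-integrable X (fun x => (midpoint f g x * h x)%:E).
  move=> fi gi.
  have := integrableZl mX 2^-1 (integrableD mX fi gi); apply: eq_integrable => // x _.
  by rewrite /= /midpoint -EFinD -EFinM; congr EFin; ring.
have vmid (f g h : spacetime -> R) :
    lambda.-integrable X (fun x => (f x * h x)%:E) ->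
    lambda.-integrable X (fun x => (g x * h x)%:E) ->
    \int[lambda]_(x in X) (midpoint f g x * h x) =
    2^-1 * (\int[lambda]_(x in X) (f x * h x) + \int[lambda]_(x in X) (g x * h x)).
  move=> fi gi; rewrite midM RintegralZl//; last exact: (integrableD mX fi gi).
  by rewrite RintegralD.
split.
  split; [by split; [exact: mmid|exact: imid]|by split; [exact: mmid|exact: imid]|].
  exact: midpoint_admissible.
move=> phi' psi' a'; have := max0 _ _ a'; have := max1 _ _ a'.
rewrite /dual_value !vmid//; lra.
Qed.

(** Replacing [phi] by the c-transform of [psi], which dominates it on [X], keeps the pair
    admissible. Optimality then makes the integral of the nonnegative gap times [mu] vanish, and
    positivity of [mu] kills the gap almost everywhere. *)
Lemma optimal_eq_ctrans X mu nu phi psi : compact X -> class_U X mu ->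
  optimal_pair X mu nu phi psi ->
  {ae lambda, forall x, X x -> phi x = ctrans X psi x}.
Proof.
move=> cX Umu [[[mphi iphi] [mpsi ipsi] adm] opt].
have [->|/set0P[x0 Xx0]] := eqVneq X set0; first exact: aeW.
have mX := Defs.compact_measurable cX.
have mc := measurable_ctrans cX adm.
have [M [_ XM]] := compact_bounded cX.
have {}XM x : X x -> `|x| <= `|M| + 1.
  by move=> Xx; apply: XM => //; rewrite (le_lt_trans (ler_norm _))// ltrDl.
have [B cB] := ctrans_bounded Xx0 adm XM.
have ic : lambda.-integrable X (fun x => (ctrans X psi x * mu x)%:E).
  have bc : [bounded ctrans X psi x | x in X].
    exists B; split; first exact: num_real.
    by move=> B' BB' x /= Xx; rewrite (le_trans (cB _ Xx))// ltW.
  exact: (integrableMr mX mc bc (density_integrable mX Umu.1)).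
have ge x : X x -> phi x <= ctrans X psi x.
  by move=> Xx; apply: (ctrans_ge Xx0 adm) => // y; exact: adm.
have := opt (ctrans X psi) psi (And3 (conj mc ic) (conj mpsi ipsi)
  (fun x y Xx Xy => ctrans_admissible Xx0 adm Xx Xy)).
rewrite /dual_value lerD2r => le.
pose w x := ctrans X psi x * mu x - phi x * mu x.
have iw : lambda.-integrable X (EFin \o w) by exact: (integrableB mX ic iphi).
have mw := measurable_int _ iw.
have w0 : {ae lambda, forall x, X x -> 0 <= w x}.
  have := Umu.1; case=> _ mu0 _; apply: filterS mu0 => x mux Xx.
  by rewrite /w -mulrBl mulr_ge0 ?subr_ge0 ?ge ?mux.
have : (\int[lambda]_(x in X) `|(EFin \o w) x| = 0)%E.
  have -> : (\int[lambda]_(x in X) `|(EFin \o w) x| = \int[lambda]_(x in X) (EFin \o w) x)%E.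
    apply: ae_eq_integral => //; first exact: measurableT_comp.
    by apply: filterS w0 => x h Xx /=; rewrite ger0_norm ?h.
  apply/eqP; rewrite eq_le; apply/andP; split.
    rewrite -(fineK (integrable_fin_num mX iw)) lee_fin.
    rewrite -[leLHS]/(\int[lambda]_(x in X) (ctrans X psi x * mu x - phi x * mu x)).
    by rewrite RintegralB// subr_le0.
  rewrite (_ : (\int[lambda]_(x in X) _ = \int[lambda]_(x in X) `|(EFin \o w) x|)%E).
    by apply: integral_ge0 => x _; exact: abse_ge0.
  apply: ae_eq_integral => //; first exact: measurableT_comp.
  by apply: filterS w0 => x h Xx /=; rewrite ger0_norm ?h.
move=> /(ae_eq_integral_abs _ mX mw).
apply: filterS2 (class_U_gt0 mX Umu) => x mux wx Xx.
have := wx Xx => /= -[/eqP]; rewrite /w -mulrBl mulf_eq0 (gt_eqF (mux Xx)) orbF.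
by rewrite subr_eq0 => /eqP.
Qed.

Lemma kantorovich_potential_unique X U mu nu phi0 phi1 :
  compact X -> open U -> U !=set0 -> path_connected U R -> X = closure U ->
  class_U X mu ->
  kantorovich_potential X mu nu phi0 -> kantorovich_potential X mu nu phi1 ->
  exists c, {ae lambda, forall x, X x -> phi0 x = phi1 x + c}.
Proof.
move=> cX oU [x0 Ux0] cU XE Umu [psi0 a0 o0] [psi1 a1 o1].
have [_ _ adm0] := a0; have [_ _ adm1] := a1.
have mX := Defs.compact_measurable cX.
have UX : U `<=` X by rewrite XE; exact: subset_closure.
have XU : X `<=` closure U by rewrite XE.
have [M [_ XM]] := compact_bounded cX.
have {}XM x : X x -> `|x| <= `|M| + 1.
  by move=> Xx; apply: XM => //; rewrite (le_lt_trans (ler_norm _))// ltrDl.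
have op0 : optimal_pair X mu nu phi0 psi0 by [].
have op1 : optimal_pair X mu nu phi1 psi1 by [].
have e0 := optimal_eq_ctrans cX Umu op0.
have e1 := optimal_eq_ctrans cX Umu op1.
have em := optimal_eq_ctrans cX Umu (optimal_midpoint mX op0 op1).
pose L := 2 * n.+1%:R * (`|M| + 1).
have L0 : 0 <= L by rewrite !mulr_ge0// addr_ge0.
(* Three uses of [optimal_eq_ctrans] give the identity almost everywhere; since both sides are
   Lipschitz and balls have positive measure, it holds at every point of [U]. *)
have mid x : U x -> ctrans X (midpoint psi0 psi1) x =
    midpoint (ctrans X psi0) (ctrans X psi1) x.
  move=> Ux; apply/eqP; rewrite -subr_eq0 -normr_le0; apply/ler_addgt0Pl => e epos.
  rewrite addr0.
  have /nbhs_ballP[d /= d0 dU] : nbhs x U by exact: open_nbhs_nbhs.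
  (* Within [d] the ball stays in [U]; within the other radius each side moves by at most
     [e / 2]. *)
  pose d' := Num.min d (e / (2 * L + 1)).
  have L1 : 0 < 2 * L + 1 by rewrite ltr_pwDr// mulr_ge0.
  have d'0 : 0 < d' by rewrite lt_min d0 divr_gt0.
  have [z zx zmid] : exists2 z, ball x d' z & ctrans X (midpoint psi0 psi1) z =
      midpoint (ctrans X psi0) (ctrans X psi1) z.
    apply: contrapT => nz.
    have : lambda.-negligible (ball x d').
      have : {ae lambda, forall z, ~ ball x d' z}.
        move: (e0) (e1) (em); apply: filterS3 => z z0 z1 zm zx; apply: nz.
        have Xz : X z by apply/UX/dU; apply: le_ball zx; rewrite ge_min lexx.
        by exists z => //; rewrite -zm// /midpoint z0// z1.
      by apply: negligibleS => z zb /(_ zb).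
    move/(negligibleP _ (measurable_ball_spacetime _ d'0)) => b0.
    by have := lebesgue_spacetime_ball_gt0 x d'0; rewrite b0 ltxx.
  have Xz : X z by apply/UX/dU; apply: le_ball zx; rewrite ge_min lexx.
  have Xx := UX _ Ux.
  have b0 := ctrans_lipschitz Xx adm0 XM Xz Xx.
  have b1 := ctrans_lipschitz Xx adm1 XM Xz Xx.
  have bm := ctrans_lipschitz Xx (midpoint_admissible adm0 adm1) XM Xz Xx.
  have : `|x - z| < e / (2 * L + 1).
    by move: zx; rewrite -ball_normE /= => /lt_le_trans; apply; rewrite ge_min lexx orbT.
  rewrite ltr_pdivlMr// => lt.
  move: b0 b1 bm zmid; rewrite -/L /midpoint.
  have h : L * `|x - z| <= e / 2 by have := normr_ge0 (x - z); nra.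
  move=> /ler_normlP[b0 b0'] /ler_normlP[b1 b1'] /ler_normlP[bm bm'] zmid.
  apply/ler_normlP; split; lra.
exists (ctrans X psi0 x0 - ctrans X psi1 x0).
apply: filterS2 e0 e1 => x h0 h1 Xx; rewrite h0// h1//.
have := ctrans_sub_cst adm0 adm1 XM oU UX XU cU Ux0 mid Xx; lra.
Qed.

End kantorovich_potentials.

(** * Inner product and adjoints on the quotient space [L2] *)

Section L2_theory.
Context {d} {T : measurableType d} {R : realType}.
Context (mu : {measure set T -> \bar R}).
Implicit Types (f g h : L2 mu).

Lemma L2_fun_Lfun f : (f : T -> R) \in Lfun mu 2.
Proof. exact: LfunP. Qed.

Lemma L2_fun_measurable f : measurable_fun setT (f : T -> R).
Proof. by have /sub_Lfun_mfun := L2_fun_Lfun f; rewrite inE. Qed.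

Lemma L2_ae_eqP f g : (f : T -> R) = g %[ae mu] -> f = g.
Proof. by move=> fg; rewrite -[f]reprK -[g]reprK; apply/L2_piP. Qed.


Lemma L2_class_ae (F : T -> R) : F \in Lfun mu 2 ->
  (L2_class mu F : T -> R) = F %[ae mu].
Proof.
move=> F2; rewrite /L2_class; case: pselect => // p.
exact: (L2_repr_pi (Lfun_Sub (lee1n 2) p)).
Qed.

Lemma L2_subE f g :
  {ae mu, forall x, (f - g : L2 mu) x = f x - g x}.
Proof.
have -> : f - g = \pi_(L2 mu)%qT (repr f - repr g).
  rewrite -[f in LHS]reprK -[g in LHS]reprK -[LHS]/(L2_add _ (L2_opp _)).
  by rewrite L2_oppE L2_addE.
by apply: filterS (L2_repr_pi (repr f - repr g)) => x /(_ I).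
Qed.

Lemma L2_integrableM f g :
  mu.-integrable setT (EFin \o (fun x => f x * g x)).
Proof. by apply/Lfun1_integrable/Lfun2_mul_Lfun1; exact: L2_fun_Lfun. Qed.

Lemma Rintegral_ae_eq (F G : T -> R) : measurable_fun setT F ->
  measurable_fun setT G -> {ae mu, forall x, F x = G x} ->
  \int[mu]_x F x = \int[mu]_x G x.
Proof.
move=> mF mG FG; congr fine; apply: ae_eq_integral => //; try exact/measurable_EFinP.
by apply: filterS FG => x /= ->.
Qed.

Lemma L2_dotBr f g h : L2_dot f (g - h) = L2_dot f g - L2_dot f h.
Proof.
rewrite /L2_dot -RintegralB//; [|exact: L2_integrableM..].
apply: Rintegral_ae_eq.
- by apply: measurable_funM; exact: L2_fun_measurable.
- by apply: measurable_funB; apply: measurable_funM; exact: L2_fun_measurable.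
by apply: filterS (L2_subE g h) => x ->; rewrite mulrBr.
Qed.

Lemma L2_dot_eq0 f : L2_dot f f = 0 -> f = 0.
Proof.
pose F (x : T) : R := f x * f x.
have mff : mu.-integrable setT (EFin \o F) := L2_integrableM f f.
move=> f0; have : (\int[mu]_x `|(EFin \o F) x| = 0)%E.
  transitivity (\int[mu]_x (EFin \o F) x)%E.
    by apply: eq_integral => x _ /=; rewrite ger0_norm// /F -expr2 sqr_ge0.
  by rewrite -(fineK (integrable_fin_num measurableT mff)) -[fine _]/(L2_dot f f) f0.
move/(ae_eq_integral_abs _ measurableT (measurable_int _ mff)) => ff.
apply: L2_ae_eqP; have := L2_repr_pi (0 : LfunType mu (lee1n 2)); move: ff.
apply: filterS2 => x /(_ I) /= [/eqP]; rewrite /F -expr2 sqrf_eq0 => /eqP -> e _.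
by rewrite [RHS]e.
Qed.

(** The difference [B f - B g] is paired with itself, and the adjoint relation moves [B] to the
    other side as [A]. *)
Lemma L2_adjoint_eq (A B : L2 mu -> L2 mu) f g : L2_adjoint A B ->
  (forall h, L2_dot (A h) f = L2_dot (A h) g) -> B f = B g.
Proof.
move=> AB Afg; apply/eqP; rewrite -subr_eq0; apply/eqP/L2_dot_eq0.
by rewrite L2_dotBr -!AB Afg subrr.
Qed.

End L2_theory.

(** * Integration as a bounded functional, and invariance under added constants *)

Section L2_finite_measure.
Context {d} {T : measurableType d} {R : realType}.
Context (mu : {measure set T -> \bar R}).
Context (mu_fin : mu setT \is a fin_num).
Implicit Types (f g h : L2 mu).

Lemma cst_Lfun2 (c : R) : cst c \in Lfun mu 2.
Proof.
have one : cst 1 \in Lfun mu 2.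
  rewrite inE; apply/andP; split; rewrite inE//= /finite_norm.
  by rewrite Lnorm_cst1 poweR_lty// ltey_eq mu_fin.
rewrite (_ : cst c = c \o* cst 1); first exact: Lfun_scale (ler1n _ 2) one.
by apply/funext => x /=; rewrite mul1r.
Qed.

Lemma L2_integrable f : mu.-integrable setT (EFin \o (f : T -> R)).
Proof.
by apply/Lfun1_integrable; apply: (Lfun_subset12 mu_fin); exact: L2_fun_Lfun.
Qed.

Definition L2_int f : R := \int[mu]_x f x.

Lemma L2_intB f g : L2_int (f - g) = L2_int f - L2_int g.
Proof.
rewrite /L2_int -RintegralB//; [|exact: L2_integrable..].
apply: Rintegral_ae_eq; first exact: L2_fun_measurable.
  by apply: measurable_funB; exact: L2_fun_measurable.
exact: L2_subE.
Qed.

Lemma L2_intZ (a : R) f : L2_int (a *: f) = a * L2_int f.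
Proof.
rewrite /L2_int -RintegralZl//; last exact: L2_integrable.
apply: Rintegral_ae_eq; first exact: L2_fun_measurable.
  by apply: measurable_funM => //; exact: L2_fun_measurable.
have -> : a *: f = \pi_(L2 mu)%qT (a *: repr f).
  by rewrite -[f in LHS]reprK -[LHS]/(L2_scale _ _) L2_scaleE.
by apply: filterS (L2_repr_pi (a *: repr f)) => x /(_ I).
Qed.

(** Hölder's inequality against the constant 1, whose norm serves as [C]. *)
Lemma L2_int_bounded : exists2 C : R, 0 <= C & forall f, `|L2_int f| <= C * `|f|.
Proof.
have n1 : ('N[mu]_2[EFin \o cst 1%R] \is a fin_num)%E.
  rewrite ge0_fin_numE ?Lnorm_ge0//.
  by have := cst_Lfun2 1; rewrite inE => /andP[_]; rewrite inE.
exists (fine 'N[mu]_2[EFin \o cst 1%R]%E); first by rewrite fine_ge0// Lnorm_ge0.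
move=> f; have := @hoelder _ _ _ mu (f : T -> R) (cst 1) 2 2
  (L2_fun_measurable f) (measurable_cst _) ltac:(by []) ltac:(by []) ltac:(by lra).
have -> : (f : T -> R) \* cst 1 = f by apply/funext => x /=; rewrite mulr1.
have nf : ('N[mu]_2[EFin \o (f : T -> R)] \is a fin_num)%E.
  rewrite ge0_fin_numE ?Lnorm_ge0//.
  by have := L2_fun_Lfun f; rewrite inE => /andP[_]; rewrite inE.
rewrite -(fineK n1) -(fineK nf) Lnorm1 -[fine 'N[mu]_2[_ \o L2_fun f]]/`|f|.
rewrite -EFinM mulrC => le; rewrite -lee_fin (le_trans _ le)//.
have -> : `|L2_int f|%:E = `|\int[mu]_x (f x)%:E|%E.
  by rewrite -(fineK (integrable_fin_num measurableT (L2_integrable f))).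
by apply: le_abse_integral => //; exact: measurable_int (L2_integrable f).
Qed.

(** Every difference quotient of [D] has integral 0, and a bounded functional passes this to the
    limit. *)
Lemma L2_int_diff (D : L2 mu -> L2 mu) f (c : R) : differentiable D f ->
  (forall g, L2_int (D g) = c) -> forall h, L2_int ('d D f h) = 0.
Proof.
move=> dD Dc h; have [C C0 JC] := L2_int_bounded.
have := diff_derivable (v := h) dD; rewrite /derivable.
rewrite -(deriveE h dD) /derive => /cvgrPdist_lt cv.
apply/eqP; rewrite -normr_le0; apply/ler_addgt0Pl => e e0; rewrite addr0.
have C1 : 0 < C + 1 by rewrite ltr_wpDl.
(* One quotient close enough to the derivative suffices for each [e]; [C + 1] is positive even if
   [C] is 0. *)
have [t ht] : exists t : R, `|lim (t^-1 *: (D (t *: h + f) - D f) @[t --> 0^'])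
    - t^-1 *: (D (t *: h + f) - D f)| < e / (C + 1).
  have := cv _ (divr_gt0 e0 C1); move/filter_ex => [t ?]; by exists t.
set l := lim _ in ht *.
have -> : L2_int l = L2_int (l - t^-1 *: (D (t *: h + f) - D f)).
  by rewrite L2_intB L2_intZ L2_intB !Dc subrr mulr0 subr0.
rewrite (le_trans (JC _))//; move: ht; rewrite ltr_pdivlMr// => ht.
by rewrite (le_trans _ (ltW ht))// mulrC ler_wpM2l// lerDl.
Qed.

Lemma Lfun2_ae_addr (F G : T -> R) (c : R) : measurable_fun setT G ->
  {ae mu, forall x, F x = G x + c} -> F \in Lfun mu 2 -> G \in Lfun mu 2.
Proof.
move=> mG FG F2.
have Fc2 : F \- cst c \in Lfun mu 2.
  have [_ addc] := @Lfun_addr_closed _ _ _ mu 2 (lee1n 2).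
  exact: (addc _ _ F2 (cst_Lfun2 (- c))).
have mFc : measurable_fun setT (F \- cst c).
  by have /sub_Lfun_mfun := Fc2; rewrite inE.
move: Fc2; rewrite !inE => /andP[_]; rewrite inE /= /finite_norm => n2.
apply/andP; split; rewrite inE//= /finite_norm.
rewrite (_ : ('N[mu]_2[EFin \o G] = 'N[mu]_2[EFin \o (F \- cst c)%R])%E)//.
rewrite unlock /=; congr (_ `^ _)%E.
apply: ge0_ae_eq_integral => //.
- apply/measurable_EFinP/(measurableT_comp (measurable_powR 2)).
  exact: measurableT_comp.
- apply/measurable_EFinP/(measurableT_comp (measurable_powR 2)).
  exact: measurableT_comp.
by apply: filterS FG => x e _ /=; rewrite e addrK.
Qed.

(** Pairing with [A h], whose integral is 0, does not see the constant [c]. *)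
Lemma L2_adjoint_class_eq (A B : L2 mu -> L2 mu) (F G : T -> R) (c : R) :
  L2_adjoint A B -> (forall h, L2_int (A h) = 0) ->
  measurable_fun setT F -> measurable_fun setT G ->
  {ae mu, forall x, F x = G x + c} ->
  B (L2_class mu F) = B (L2_class mu G).
Proof.
move=> AB A0 mF mG FG.
have GF : {ae mu, forall x, G x = F x + - c}.
  by apply: filterS FG => x ->; rewrite addrK.
have [F2|nF2] := boolP (F \in Lfun mu 2); last first.
  (* Neither function is square-integrable: both classes are the junk value 0. *)
  have nG2 : G \notin Lfun mu 2 by apply: contra nF2; exact: Lfun2_ae_addr GF.
  rewrite /L2_class; case: pselect => p; first by rewrite p in nF2.
  by case: pselect => q //; rewrite q in nG2.
have G2 := Lfun2_ae_addr mG FG F2.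
apply: (L2_adjoint_eq AB) => h.
have cA0 : \int[mu]_x (c * A h x) = 0.
  by rewrite RintegralZl -/(L2_int _) ?A0 ?mulr0//; exact: L2_integrable.
rewrite -[RHS]addr0 -cA0 -RintegralD//; last 2 first.
- exact: L2_integrableM.
- exact: (integrableZl measurableT c (L2_integrable (A h))).
apply: Rintegral_ae_eq.
- by apply: measurable_funM; exact: L2_fun_measurable.
- apply: measurable_funD.
    by apply: measurable_funM; exact: L2_fun_measurable.
  by apply: measurable_funM => //; exact: L2_fun_measurable.
move: (L2_class_ae F2) (L2_class_ae G2) FG.
apply: filterS3 => x /(_ I) -> /(_ I) -> ->; ring.
Qed.

End L2_finite_measure.

(** * Lebesgue measure restricted to the data domain *)

Section restricted_measure.
Context {d} {T : measurableType d} {R : realType}.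
Context (mu : {measure set T -> \bar R}) (X : set T) (mX : measurable X).
Local Notation muX := (mrestr mu mX).

Lemma ae_mrestr (P : T -> Prop) :
  {ae mu, forall x, X x -> P x} -> {ae muX, forall x, P x}.
Proof.
move=> [N [mN N0 NP]]; exists (N `|` ~` X); split.
- by apply: measurableU => //; exact: measurableC.
- rewrite /mrestr setIUl setICl setU0; apply/eqP; rewrite eq_le measure_ge0 andbT.
  by rewrite -N0 le_measure ?inE//; exact: measurableI.
by move=> x nP; have [Xx|] := pselect (X x); [left; apply: NP => h; exact/nP/h|right].
Qed.

Lemma integral_mrestr (f : T -> \bar R) : measurable_fun setT f ->
  (\int[muX]_x f x = \int[mu]_(x in X) f x)%E.
Proof.
move=> mf.
rewrite -(@eq_measure_integral _ _ _ X mu muX); last first.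
  by move=> A mA AX; rewrite /= /mrestr setIidl.
rewrite [RHS]integral_mkcond; apply: ae_eq_integral => //.
  by apply/(measurable_restrictT _ mX); exact: measurable_funTS.
have : {ae muX, forall x, X x} by apply: ae_mrestr; exact: aeW.
by apply: filterS => x Xx _; rewrite patchE mem_set.
Qed.

Lemma restrict_Lfun2 (F : T -> R) : F \in Lfun muX 2 -> F \_ X \in Lfun mu 2.
Proof.
rewrite !inE => /andP[]; rewrite !inE /= => mF nF.
have mFX : measurable_fun setT (F \_ X).
  by apply/(measurable_restrictT _ mX); exact: measurable_funTS.
apply/andP; split; rewrite inE//= /finite_norm.
rewrite (_ : ('N[mu]_2[_] = 'N[muX]_2[EFin \o F])%E)//.
rewrite unlock /=; congr (_ `^ _)%E.
rewrite integral_mrestr; last first.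
  apply/measurable_EFinP/(measurableT_comp (measurable_powR 2)).
  exact: measurableT_comp.
rewrite [RHS]integral_mkcond; apply: eq_integral => x _.
by rewrite !patchE; case: ifPn => //= _; rewrite normr0 powR0.
Qed.

End restricted_measure.

(** * Sections of null sets and the time integral in the gradient *)

Lemma ae_xsection d1 d2 (T1 : measurableType d1) (T2 : measurableType d2)
    (R : realType) (m1 : {measure set T1 -> \bar R})
    (m2 : {sigma_finite_measure set T2 -> \bar R}) (P : T1 * T2 -> Prop) :
  {ae (m1 \x m2)%E, forall z, P z} ->
  {ae m1, forall x, {ae m2, forall t, P (x, t)}}.
Proof.
move=> [N [mN N0 NP]].
have m0 : {ae m1, forall x, m2 (xsection N x) = 0%E}.
  have mxs := measurable_fun_xsection m2 mN.
  have := (ae_eq_integral_abs m1 measurableT mxs).1.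
  (* The product measure of [N] is the integral of the measures of its sections, so almost all
     sections are null. *)
  rewrite (_ : (\int[m1]_x _ = 0)%E); last first.
    rewrite -[RHS]N0; apply: eq_integral => x _; exact: gee0_abs.
  by move=> /(_ erefl); apply: filterS => x /(_ I).
apply: filterS m0 => x x0; exists (xsection N x); split => //.
  exact: measurable_xsection.
by move=> t nP; rewrite /xsection /= inE; exact: NP.
Qed.

Lemma adjoint_gradient_ae_eq (R : realType) n (T : R)
    (v w utt : 'rV[R]_n * R -> R) :
  measurable_fun (slab T) v -> measurable_fun (slab T) w ->
  L2_on (slab T) utt ->
  v = w %[ae lebesgue_spacetime in slab T] ->
  adjoint_gradient T v utt = adjoint_gradient T w utt %[ae lebesgue_rV n].
Proof.
move=> mv mw u2 vw.
have mslab : measurable (slab T : set ('rV[R]_n * R)) by exact: measurableX.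
have mu : measurable_fun (slab T) utt.
  apply/(measurable_restrictT _ mslab).
  by have /sub_Lfun_mfun := u2; rewrite inE.
have msec (f : 'rV[R]_n * R -> R) x : measurable_fun (slab T) f ->
    measurable_fun `[0, T] (fun t => (f (x, t) * utt (x, t))%:E).
  move=> mf; apply/measurable_EFinP.
  have pairm : measurable_fun setT (fun t : R => (x, t)) by exact: pair1_measurable.
  have mfu : measurable_fun (slab T) (fun z => f z * utt z) by exact: measurable_funM.
  apply: (@measurable_comp _ _ _ _ _ _ (slab T) (fun z => f z * utt z)) => //.
    by move=> _ [t tT <-].
  exact: measurable_funTS.
have := ae_xsection vw; apply: filterS => x vwx _.
rewrite /adjoint_gradient /Rintegral; congr (- fine _).
apply: ae_eq_integral => //; [exact: msec|exact: msec|].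
by apply: filterS vwx => t h tT; rewrite h.
Qed.

(** * Independence of the adjoint-state gradient from the potential *)

Theorem theorem10 (R : realType) (n : nat) (T : R)
    (m rho : 'rV[R]_n -> R) (f : 'rV[R]_n * R -> R) (u0 u1 : 'rV[R]_n -> R)
    (u utt : 'rV[R]_n * R -> R)
    (X : set ('rV[R]_n * R)) (cX : compact X)
    (D : L2_data cX -> L2_data cX) (nu : 'rV[R]_n * R -> R)
    (Dadj : L2_data cX -> L2_data cX) :
  0 < T -> coefficient m -> coefficient rho ->
  locally_integrable_on (slab T) f ->
  well_posed m rho T f 0 u0 u1 ->
  (forall F, L2_on (slab T) F -> well_posed m rho T F T (fun=> 0) (fun=> 0)) ->
  wave_solution m rho T f 0 u0 u1 u ->
  L2_on (slab T) utt -> weak_dtt T u utt ->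
  data_domain T X ->
  (forall w, class_U X (D w)) -> class_U X nu ->
  (forall w, differentiable D w) ->
  L2_adjoint ('d D (restrict_data cX u)) Dadj ->
  forall phi0 phi1 v0 v1 : 'rV[R]_n * R -> R,
    kantorovich_potential X (D (restrict_data cX u)) nu phi0 ->
    kantorovich_potential X (D (restrict_data cX u)) nu phi1 ->
    wave_solution m rho T (extend_data (Dadj (restrict_data cX phi0)))
      T (fun=> 0) (fun=> 0) v0 ->
    wave_solution m rho T (extend_data (Dadj (restrict_data cX phi1)))
      T (fun=> 0) (fun=> 0) v1 ->
    adjoint_gradient T v0 utt = adjoint_gradient T v1 utt
      %[ae lebesgue_rV n].
Proof.
move=> T0 _ _ _ _ wp _ u2 _ [XT [U [oU _ U0 [cU _] XE]]] DU nuU dD adj.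
move=> phi0 phi1 v0 v1 k0 k1 s0 s1.
set muX := mrestr lebesgue_spacetime (Defs.compact_measurable cX)
  in D Dadj DU dD adj k0 k1 s0 s1 *.
have mX := Defs.compact_measurable cX.
have [c phic] := kantorovich_potential_unique cX oU U0 cU XE (DU _) k0 k1.
(* The lower bound for [nu] on all of [X] gives [r] times the measure of [X] at most 1. *)
have fin : muX setT \is a fin_num.
  rewrite ge0_fin_numE ?measure_ge0// /muX /mrestr setTI.
  have [[_ _ nu1] [r r0 /(_ X mX (@subset_refl _ X))]] := nuU.
  rewrite nu1 => le; rewrite ltNge leye_eq; apply/negP => /eqP e.
  by move: le; rewrite e gt0_muley.
have Dint w : L2_int (D w) = 1.
  have [[_ _ Dw1] _] := DU w.
  rewrite /L2_int /Rintegral integral_mrestr ?Dw1//.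
  exact/measurable_EFinP/L2_fun_measurable.
have mphi (phi : 'rV[R]_n * R -> R) : measurable_fun X phi -> measurable_fun setT (phi \_ X).
  by move=> h; exact/(measurable_restrictT _ mX).
have B01 : Dadj (restrict_data cX phi0) = Dadj (restrict_data cX phi1).
  apply: (L2_adjoint_class_eq fin adj (L2_int_diff fin (dD _) Dint)).
  - by apply: mphi; have [? [[]]] := k0.
  - by apply: mphi; have [? [[]]] := k1.
  - apply: ae_mrestr; apply: filterS phic => x h Xx.
    by rewrite !patchE mem_set// h.
have wp0 : well_posed m rho T (extend_data (Dadj (restrict_data cX phi0))) T
    (fun=> 0) (fun=> 0).
  apply: wp; rewrite /L2_on /extend_data.
  (* As [X] lies in the slab, cutting the extension by zero down to the slab changes nothing. *)
  rewrite (_ : _ \_ (slab T) = (Dadj (restrict_data cX phi0) : _ -> R) \_ X).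
    by apply: (restrict_Lfun2 (mX := Defs.compact_measurable cX)); exact: L2_fun_Lfun.
  apply/funext => z; rewrite !patchE; case: ifPn => // zT; case: ifPn => // zX.
  by move: zT; rewrite mem_set//; apply: XT; exact: set_mem.
have [v vs vu] := wp0.
(* By [B01] both functions solve the problem with the same source, hence both agree with its unique
   solution [v]. *)
have v01 : v0 = v1 %[ae lebesgue_spacetime in slab T].
  by apply: (ae_eq_trans (ae_eq_sym (vu _ s0))); apply: vu; rewrite B01.
apply: adjoint_gradient_ae_eq => //.
  by have [? [? [[[]]]]] := s0.
by have [? [? [[[]]]]] := s1.
Qed.
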